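(* Let $\lambda\in\mathbb{R}$, let $p$ be a positive integer and let $r\ge 0$ be an integer. Then for all real $x$ with $|x|<1$, \[ \Big(x\frac{d}{dx}\Big)_{p,\lambda}\Big(\frac{1}{1-x}\Big)^{r+1}=\sum_{n=0}^{\infty}\binom{n+r}{n}(n)_{p,\lambda}x^n=\Big(\frac{1}{1-x}\Big)^{r+1}\big(D_rF_{p,\lambda}\big)\Big(\frac{x}{1-x}\Big), \] where $D_r$ is the linear operator on polynomials given by $D_rq(y)=\frac{1}{r!}\big(\frac{d}{dy}\big)^r\big[y^rq(y)\big]$, and $(D_rF_{p,\lambda})(x/(1-x))$ means the polynomial $D_rF_{p,\lambda}$ evaluated at $y=x/(1-x)$.
   Context: For $\lambda\in\mathbb{R}$, the generalized falling factorials are $(x)_{0,\lambda}=1$ and $(x)_{n,\lambda}=x(x-\lambda)(x-2\lambda)\cdots(x-(n-1)\lambda)$ for $n\ge 1$. The degenerate differential operator is $\big(x\frac{d}{dx}\big)_{n,\lambda}=\big(x\frac{d}{dx}\big)\big(x\frac{d}{dx}-\lambda\big)\cdots\big(x\frac{d}{dx}-(n-1)\lambda\big)$ for $n\ge1$. The degenerate exponential is the formal power series $e_\lambda(t)=\sum_{n\ge 0}(1)_{n,\lambda}\frac{t^n}{n!}$. The degenerate Fubini polynomials $F_{n,\lambda}(x)$ are defined by $\frac{1}{1-x(e_\lambda(t)-1)}=\sum_{n=0}^{\infty}F_{n,\lambda}(x)\frac{t^n}{n!}$ (as formal power series in $t$). *)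

(* Defs.v *)
(* MathComp / MathComp-Analysis. *)
From HB Require Import structures.
From mathcomp Require Import all_boot all_order all_algebra.
From mathcomp Require Import all_classical all_reals all_analysis.

Set Implicit Arguments.
Unset Strict Implicit.
Unset Printing Implicit Defensive.

Import Order.TTheory GRing.Theory Num.Theory.
Import numFieldNormedType.Exports.

Local Open Scope classical_set_scope.
Local Open Scope ring_scope.

(* A formal power series is represented by its sequence of coefficients.      *)
(* Multiplication is the Cauchy product, not the pointwise product that       *)
(* functions inherit from their codomain.                                     *)
Definition fps_one (A : nzRingType) : nat -> A := fun n => (n == 0%N)%:R.

Definition fps_mul (A : nzRingType) (f g : nat -> A) : nat -> A :=
  fun n => \sum_(i < n.+1) f i * g (n - i)%N.

(* Coefficients 0, ..., n - 1 of 1 / f, obtained by solving f * g = 1 degree  *)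
(* by degree; meaningful when f 0 is a unit (see fps_mulV).                   *)
Fixpoint fps_inv_prefix (A : unitRingType) (f : nat -> A) (n : nat) : seq A :=
  if n is m.+1 then
    let s := fps_inv_prefix f m in
    rcons s ((f 0%N)^-1 * ((m == 0%N)%:R - \sum_(i < m) f (m - i)%N * s`_i))
  else [::].

Definition fps_inv (A : unitRingType) (f : nat -> A) : nat -> A :=
  fun n => (fps_inv_prefix f n.+1)`_n.

Lemma size_fps_inv_prefix (A : unitRingType) (f : nat -> A) n :
  size (fps_inv_prefix f n) = n.
Proof. by elim: n => //= n IHn; rewrite size_rcons IHn. Qed.

Lemma nth_fps_inv_prefix (A : unitRingType) (f : nat -> A) n i :
  (i < n)%N -> (fps_inv_prefix f n)`_i = fps_inv f i.
Proof.
elim: n => // n IHn; rewrite ltnS leq_eqVlt => /orP[/eqP->//|lt_in].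
by rewrite /= nth_rcons size_fps_inv_prefix lt_in IHn.
Qed.

Lemma fps_mulV (A : unitRingType) (f : nat -> A) :
  f 0%N \is a GRing.unit -> fps_mul f (fps_inv f) = fps_one A.
Proof.
move=> f0U; apply/funext => n; rewrite /fps_mul big_ord_recl subn0 /=.
rewrite {1}/fps_inv /= nth_rcons size_fps_inv_prefix ltnn eqxx mulVKr //.
rewrite [X in _ - X + _](_ : _ = \sum_(i < n) f (n - i)%N * fps_inv f i).
  rewrite [X in _ + X](reindex_inj rev_ord_inj) /=.
  rewrite [X in _ + X](_ : _ = \sum_(i < n) f (n - i)%N * fps_inv f i).
    by rewrite subrK.
  apply: eq_bigr => i _; rewrite /bump /= add1n -subSn ?ltn_ord // subSS.
  by rewrite subKn // ltnW.
by apply: eq_bigr => i _; rewrite nth_fps_inv_prefix.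
Qed.

Section Degenerate.
Variable R : realType.
Implicit Types (lam x : R) (n p r : nat).

(* dfalling lam n x stands for (x)_{n,lam}. *)
Definition dfalling lam n x : R := \prod_(i < n) (x - i%:R * lam).

(* (x d/dx)_{n,lam}: the factor x d/dx - (n - 1) lam is applied first. *)
Fixpoint deuler lam n (f : R -> R) : R -> R :=
  if n is m.+1 then deuler lam m (fun x => x * f^`()%classic x - m%:R * lam * f x)
  else f.

(* e_lam(t), as a power series in t. *)
Definition dexp lam : nat -> R := fun n => dfalling lam n 1 / n`!%:R.

(* 1 - x (e_lam(t) - 1), a power series in t over R[x]; 'X stands for x. *)
Definition dfubini_denom lam : nat -> {poly R} :=
  fun n => fps_one {poly R} n - 'X * ((dexp lam n)%:P - fps_one {poly R} n).

(* The degenerate Fubini polynomial F_{n,lam}; its generating function is      *)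
(* dfubini_gf.                                                                *)
Definition dfubini lam n : {poly R} :=
  n`!%:R *: fps_inv (dfubini_denom lam) n.

(* The operator D_r q = (1 / r!) (d/dy)^r [y^r q(y)], on formal polynomials. *)
Definition opD r (q : {poly R}) : {poly R} :=
  r`!%:R^-1 *: ('X^r * q)^`(r).

Lemma dfubini_gf lam :
  fps_mul (dfubini_denom lam) (fun n => n`!%:R^-1 *: dfubini lam n)
    = fps_one {poly R}.
Proof.
rewrite (_ : (fun n => _) = fps_inv (dfubini_denom lam)).
  apply: fps_mulV; rewrite /dfubini_denom /fps_one eqxx /dexp /dfalling.
  by rewrite big_ord0 fact0 divr1 subrr mulr0 subr0 unitr1.
by apply/funext => n; rewrite /dfubini scalerA mulVf ?scale1r.
Qed.

End Degenerate.

(* Main.v *)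
(* From the generating function one gets the recursion
     F_n = [n = 0] + X sum_{i >= 1} C(n, i) (1)_{i,lam} F_{n-i}.
   Comparing it with the Vandermonde identity for (j + 1)_{n,lam} shows that
   (j)_{n,lam} = sum_k F_{n,k} C(j, k), where F_{n,k} is the coefficient of X^k
   in F_n.  Since C(j + r, r) C(j, k) = C(k + r, r) C(j + r, k + r) and
     sum_j C(j + r, k + r) x^j = x^k / (1 - x)^(k + r + 1),
   the series equals (1 - x)^(-r-1) sum_k C(k + r, r) F_{n,k} (x / (1 - x))^k,
   and C(k + r, r) F_{n,k} is the k-th coefficient of D_r F_n.  The differential
   operator is applied to (1 - x)^(-r-1) = sum_j C(j + r, r) x^j term by term. *)
Require Import Defs.
From HB Require Import structures.
From mathcomp Require Import all_boot all_order all_algebra.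
From mathcomp Require Import all_classical all_reals all_analysis.
From mathcomp Require Import ring lra zify.

Import Order.TTheory GRing.Theory Num.Theory.
Import numFieldNormedType.Exports.

Local Open Scope classical_set_scope.
Local Open Scope ring_scope.

(** * Degenerate falling factorials and the Fubini recursion *)

Lemma dfallingS (R : realType) (lam : R) n (x : R) :
  dfalling lam n.+1 x = dfalling lam n x * (x - n%:R * lam).
Proof. by rewrite /dfalling big_ord_recr. Qed.

(** Induction on [n]: the new factor splits as (y - (n - i) lam) + (x - i lam), and Pascal's rule
    regroups the terms. *)
Lemma dfallingD (R : realType) (lam : R) n (x y : R) :
  dfalling lam n (x + y)
    = \sum_(i < n.+1) 'C(n, i)%:R * dfalling lam i x * dfalling lam (n - i) y.
Proof.
elim: n => [|n IHn].
  by rewrite big_ord_recl big_ord0 /dfalling !big_ord0 bin0 !mulr1 addr0.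
rewrite dfallingS IHn mulr_suml.
under eq_bigr => i _.
  have -> : 'C(n, i)%:R * dfalling lam i x * dfalling lam (n - i) y
      * (x + y - n%:R * lam)
    = 'C(n, i)%:R * dfalling lam i x * dfalling lam (n.+1 - i) y
      + 'C(n, i)%:R * dfalling lam i.+1 x * dfalling lam (n - i) y.
    rewrite subSn -1?ltnS // !dfallingS natrB -1?ltnS //; ring.
  over.
rewrite big_split /= [RHS]big_ord_recl /= big_ord_recl /= !bin0 -addrA.
congr (_ + _); rewrite [in RHS](eq_bigr (fun i : 'I_n.+1 =>
    'C(n, i.+1)%:R * dfalling lam i.+1 x * dfalling lam (n - i) y
    + 'C(n, i)%:R * dfalling lam i.+1 x * dfalling lam (n - i) y));
  last by move=> i _; rewrite /bump /= add1n subSS binS natrD; ring.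
rewrite big_split /=; congr (_ + _).
by rewrite [RHS]big_ord_recr /= bin_small // !mul0r addr0.
Qed.

(** Forward difference in [j], in the shape of the sum in [dfubini_rec]. *)
Lemma dfalling_natS (R : realType) (lam : R) n j :
  dfalling lam n j.+1%:R
    = dfalling lam n j%:R
      + \sum_(i < n) 'C(n, i.+1)%:R * dfalling lam i.+1 1
                     * dfalling lam (n - i.+1) j%:R.
Proof.
rewrite -nat1r dfallingD big_ord_recl bin0 subn0 {1}/dfalling big_ord0 !mul1r.
by congr (_ + _); apply: eq_bigr => i _.
Qed.

Lemma dfalling0 (R : realType) (lam : R) n :
  dfalling lam n 0 = (n == 0%N)%:R.
Proof.
case: n => [|n]; rewrite /dfalling ?big_ord0 //.
by rewrite big_ord_recl mul0r subr0 mul0r.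
Qed.

(** The first term of the Cauchy product in [dfubini_gf] is F_n / n!; the identity at degree n is
    solved for it and scaled by n!. *)
Lemma dfubini_rec (R : realType) (lam : R) n :
  dfubini lam n = (n == 0%N)%:R
    + 'X * \sum_(i < n) ('C(n, i.+1)%:R * dfalling lam i.+1 1)
                        *: dfubini lam (n - i.+1).
Proof.
have /(congr1 (fun f => n`!%:R *: f n)) := dfubini_gf lam.
have fN0 m : m`!%:R != 0 :> R by rewrite pnatr_eq0 -lt0n fact_gt0.
rewrite /fps_mul big_ord_recl subn0 /dfubini_denom {1 2}/fps_one eqxx.
rewrite /dexp /dfalling big_ord0 fact0 divr1 subrr mulr0 subr0 mul1r.
rewrite scalerDr scalerA divff // scale1r => /(canRL (addrK _)) ->.
congr (_ + _).
  rewrite /fps_one; case: n => [|n]; first by rewrite scale1r.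
  by rewrite scaler0.
rewrite scaler_sumr -sumrN mulr_sumr; apply: eq_bigr => i _.
rewrite /fps_one lift0 /= sub0r subr0 -/(dfalling lam i.+1 1).
rewrite mulNr scalerN opprK -mulrA -scalerAr -scalerAr mul_polyC.
rewrite -scalerAr -[RHS]scalerAr 2!scalerA; congr (_ *: _).
rewrite -(@bin_fact n i.+1) // (natrM _ 'C(n, i.+1)) (natrM _ (i.+1)`!).
by move: (fN0 i.+1) (fN0 (n - i.+1)%N);
  move: (i.+1)`!%:R ((n - i.+1)`!)%:R => a b a0 b0; field; rewrite a0.
Qed.

(** * Newton series *)

(* Newton series with coefficients p: X^k stands for the binomial coefficient
   C(j, k), so that multiplication by X becomes summation in j. *)
Definition newton_eval (A : nzRingType) (p : {poly A}) (j : nat) : A :=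
  \sum_(k < j.+1) p`_k * 'C(j, k)%:R.
Arguments newton_eval {A} p j.

Lemma newton_eval0 (A : nzRingType) (p : {poly A}) : newton_eval p 0 = p`_0.
Proof. by rewrite /newton_eval big_ord1 bin0 mulr1. Qed.

Lemma newton_evalD (A : nzRingType) (p q : {poly A}) j :
  newton_eval (p + q) j = newton_eval p j + newton_eval q j.
Proof.
by rewrite /newton_eval -big_split; apply: eq_bigr => k _; rewrite coefD mulrDl.
Qed.

Lemma newton_eval_sum (A : nzRingType) n (a : nat -> A) (p : nat -> {poly A}) j :
  newton_eval (\sum_(i < n) a i *: p i) j
    = \sum_(i < n) a i * newton_eval (p i) j.
Proof.
rewrite /newton_eval; under [RHS]eq_bigr do rewrite mulr_sumr.
rewrite [RHS]exchange_big; apply: eq_bigr => k _ /=.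
by rewrite coef_sum mulr_suml; apply: eq_bigr => i _; rewrite coefZ mulrA.
Qed.

Lemma newton_eval_natr (A : nzRingType) m j :
  newton_eval (m%:R : {poly A}) j = m%:R.
Proof.
rewrite /newton_eval big_ord_recl bin0 mulr1 -polyC_natr coefC eqxx.
by rewrite big1 ?addr0 // => k _; rewrite coefC mul0r.
Qed.

Lemma newton_evalXS (A : nzRingType) (p : {poly A}) j :
  newton_eval ('X * p) j.+1 = newton_eval ('X * p) j + newton_eval p j.
Proof.
rewrite /newton_eval big_ord_recl coefXM mul0r add0r.
under eq_bigr do rewrite coefXM /= binS natrD mulrDr.
rewrite big_split; congr (_ + _).
rewrite big_ord_recr /= bin_small // mulr0 addr0.
rewrite [RHS]big_ord_recl coefXM mul0r add0r.
by apply: eq_bigr => k _; rewrite coefXM.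
Qed.

(** Terms with k >= size p vanish through the coefficient, those with k > j through the binomial, so
    the range can be made independent of [j]. *)
Lemma newton_eval_wide (A : nzRingType) (p : {poly A}) j :
  newton_eval p j = \sum_(k < size p) p`_k * 'C(j, k)%:R.
Proof.
pose F k := p`_k * 'C(j, k)%:R.
rewrite /newton_eval (big_ord_widen (j.+1 + size p)%N F) ?leq_addr //.
rewrite [RHS](big_ord_widen (j.+1 + size p)%N F) ?leq_addl // /F.
rewrite big_mkcond [RHS]big_mkcond /=.
apply: eq_bigr => k _; case: ifPn => [_|]; case: ifPn => //.
  by rewrite -leqNgt => /leq_sizeP->//; rewrite mul0r.
by rewrite -leqNgt => _ ltk; rewrite bin_small ?mulr0.
Qed.

(** Both sides agree at j = 0 and, by the hypothesis for smaller [n], have the same forward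
    difference in [j]. *)
Lemma newton_eval_dfubini (R : realType) (lam : R) n j :
  newton_eval (dfubini lam n) j = dfalling lam n j%:R.
Proof.
elim/ltn_ind: n j => n IHn; elim=> [|j IHj].
  by rewrite newton_eval0 dfubini_rec dfalling0 coefD coefXM addr0
             -polyC_natr coefC.
have stepE : newton_eval (dfubini lam n) j.+1 = newton_eval (dfubini lam n) j
    + \sum_(i < n) 'C(n, i.+1)%:R * dfalling lam i.+1 1
                   * dfalling lam (n - i.+1) j%:R.
  rewrite dfubini_rec !newton_evalD !newton_eval_natr newton_evalXS addrA.
  rewrite (newton_eval_sum _ n (fun i => 'C(n, i.+1)%:R * dfalling lam i.+1 1)
    (fun i => dfubini lam (n - i.+1))).
  congr (_ + _); apply: eq_bigr => i _; congr (_ * _); apply: IHn.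
  by have := ltn_ord i; lia.
by rewrite stepE IHj -dfalling_natS.
Qed.

(** * Binomial coefficients and the operator [opD] *)

(** For k <= j both sides times r! k! (j - k)! equal (j + r)!; for k > j both vanish. *)
Lemma mul_binDr j k r :
  ('C(j + r, r) * 'C(j, k) = 'C(k + r, r) * 'C(j + r, k + r))%N.
Proof.
have [lt_jk|le_kj] := ltnP j k.
  have -> : 'C(j + r, k + r) = 0%N by apply: bin_small; rewrite ltn_add2r.
  by rewrite (bin_small lt_jk) !muln0.
apply/eqP; rewrite -(eqn_pmul2r (fact_gt0 r)) -(eqn_pmul2r (fact_gt0 k)).
rewrite -(eqn_pmul2r (fact_gt0 (j - k))); apply/eqP.
have := @bin_fact (j + r) r (leq_addl _ _); rewrite addnK => E1.
have := @bin_fact (k + r) r (leq_addl _ _); rewrite addnK => E2.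
have := @bin_fact (j + r) (k + r); rewrite leq_add2r subnDr => /(_ le_kj) E3.
have E4 := bin_fact le_kj; transitivity (j + r)`!.
  by rewrite -E1 -E4; ring.
by rewrite -E3 -E2; ring.
Qed.

Lemma coef_opD (R : realType) r (q : {poly R}) k :
  (opD r q)`_k = 'C(k + r, r)%:R * q`_k.
Proof.
rewrite /opD coefZ coef_derivn coefXnM ltnNge leq_addr addKn /=.
rewrite -[q`_k *+ _]mulr_natl -bin_ffact natrM addnC.
by field; rewrite pnatr_eq0 -lt0n fact_gt0.
Qed.

Lemma horner_opD (R : realType) r (q : {poly R}) y :
  (opD r q).[y] = \sum_(k < size q) 'C(k + r, r)%:R * q`_k * y ^+ k.
Proof.
rewrite (@horner_coef_wide _ (size q)).
  by apply: eq_bigr => k _; rewrite coef_opD.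
by apply/leq_sizeP => k le_qk; rewrite coef_opD (leq_sizeP _ _ le_qk) ?mulr0.
Qed.

(** * Power series with binomial coefficients *)

(** C(n, k) s^k is one term in the expansion of (s + 1)^n, so s^-k ((s + 1)|x|)^n bounds the
    sequence; it tends to 0 once s is small. *)
Lemma cvg_bin_expr (R : realType) k (x : R) : `|x| < 1 ->
  (fun n => 'C(n, k)%:R * x ^+ n) @ \oo --> (0 : R).
Proof.
move=> x1.
have [s s0 q1] : exists2 s : R, 0 < s & `|(s + 1) * `|x| | < 1.
  (* With a = |x|, this s gives 1 - (s + 1) a = (1 - a)(2 - a) / 2 > 0. *)
  have ? := normr_ge0 x; exists ((1 - `|x|) / 2); first by lra.
  by rewrite normrM normr_id ger0_norm; nra.
have binle n : 'C(n, k)%:R * s ^+ k <= (s + 1) ^+ n.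
  have [ltnk|lekn] := ltnP n k.
    by rewrite bin_small // mul0r exprn_ge0 // addr_ge0 // ltW.
  rewrite exprD1n (bigD1 (Ordinal (lekn : k < n.+1)%N)) //= mulr_natl lerDl.
  by apply: sumr_ge0 => i _; rewrite mulrn_wge0 // exprn_ge0 // ltW.
apply/norm_cvg0P.
apply: (squeeze_cvgr _ (cvg_cst (0 : R)) (cvg_geometric (s ^- k) q1)).
near=> n; rewrite normr_ge0 /geometric /= normrM normr_nat normrX exprMn.
rewrite mulrA.
rewrite ler_wpM2r ?exprn_ge0 // -ler_pdivrMl ?invr_gt0 ?exprn_gt0 //.
by rewrite invrK mulrC.
Unshelve. all: by end_near. Qed.

(** Induction on [r] with [k] free, since Pascal's rule leads from (k, r + 1) to (k + 1, r) and (k,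
    r); the case r = 0 is an induction on [k]. *)
Lemma cvg_pseries_bin (R : realType) k r (x : R) : `|x| < 1 ->
  pseries (fun n => 'C(n + r, k + r)%:R) x @ \oo
    --> x ^+ k * (1 / (1 - x)) ^+ (k + r).+1.
Proof.
move=> x1; have x1N0 : 1 - x != 0.
  by rewrite subr_eq0 eq_sym lt_eqF // ltr_normlW.
elim: r k => [|r IHr] k.
  under eq_fun do rewrite addn0; rewrite addn0.
  elim: k => [|k IHk].
    under eq_fun do rewrite bin0.
    by rewrite expr0 expr1 mul1r; exact: cvg_geometric_series.
  (* Pascal's rule on partial sums leaves a boundary term in C(N, k + 1) x^N, which tends to 0. *)
  have E N : pseries (fun n => 'C(n, k.+1)%:R) x N
      = (x * pseries (fun n => 'C(n, k)%:R) x N - 'C(N, k.+1)%:R * x ^+ N)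
        * (1 / (1 - x)).
    apply: (mulIf x1N0); rewrite -mulrA mul1r mulVf // mulr1.
    rewrite /pseries /series /=; elim: N => [|N IHN].
      by rewrite !big_nil bin0n !mul0r mulr0 subr0.
    by rewrite !big_nat_recr //= mulrDl IHN binS natrD exprS; ring.
  rewrite (funext E) (_ : x ^+ k.+1 * _ =
    (x * (x ^+ k * (1 / (1 - x)) ^+ k.+1) - 0) * (1 / (1 - x)));
    last by rewrite subr0 !exprS; ring.
  apply: cvgM; last exact: cvg_cst.
  by apply: cvgB; [apply: cvgM => //; exact: cvg_cst|exact: cvg_bin_expr].
have -> : pseries (fun n => 'C(n + r.+1, k + r.+1)%:R) x
    = (fun N => pseries (fun n => 'C(n + r, k.+1 + r)%:R) x N
                + pseries (fun n => 'C(n + r, k + r)%:R) x N).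
  apply/funext => N; rewrite /pseries /series /= -big_split /=.
  by apply: eq_bigr => n _; rewrite !addnS binS natrD mulrDl.
(* With u = 1 / (1 - x), this is u = x u + 1. *)
rewrite (_ : x ^+ k * _ = x ^+ k.+1 * (1 / (1 - x)) ^+ (k.+1 + r).+1
    + x ^+ k * (1 / (1 - x)) ^+ (k + r).+1).
  exact: cvgD.
by rewrite addnS addSn !exprS; field.
Qed.

(** * Termwise differentiation *)

(** As c_n K^n is bounded, a constant times (n + 1)(|x| / |K|)^n dominates; it is summable by
    [cvg_pseries_bin] at k = 0, r = 1. *)
Lemma is_cvg_pseries_diffs (R : realType) (c : R^nat) (K x : R) :
  cvgn (pseries c K) -> `|x| < `|K| -> cvgn (pseries (pseries_diffs c) x).
Proof.
move=> /cvg_series_bounded[M [Mreal cM]] ltxK.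
have K0 : 0 < `|K| by exact: le_lt_trans ltxK.
have {}cM n : `|c n * K ^+ n| <= `|M| + 1.
  by apply: cM => //; rewrite (le_lt_trans (ler_norm M)) // ltrDl.
have q1 : `| `|x| / `|K| | < 1.
  by rewrite ger0_norm ?divr_ge0 // ltr_pdivrMr // mul1r.
apply: normed_cvg; apply: (@series_le_cvg _ _
    (fun n => (`|M| + 1) / `|K| * ('C(n + 1, 0 + 1)%:R * (`|x| / `|K|) ^+ n))).
- by move=> n; rewrite /= normr_ge0.
- move=> n; apply: mulr_ge0; first by rewrite divr_ge0 // addr_ge0.
  by rewrite mulr_ge0 // exprn_ge0 // divr_ge0.
- move=> n; rewrite /= /pseries_diffs add0n bin1 addn1.
  rewrite !normrM normr_nat normrX.
  have := cM n.+1; rewrite normrM normrX -ler_pdivlMr ?exprn_gt0 // => h.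
  have -> : (`|M| + 1) / `|K| * (n.+1%:R * (`|x| / `|K|) ^+ n)
      = n.+1%:R * ((`|M| + 1) / `|K| ^+ n.+1) * `|x| ^+ n.
    by rewrite expr_div_n exprS; field; rewrite expf_neq0 gt_eqF.
  by rewrite ler_wpM2r ?exprn_ge0 // ler_wpM2l.
have /cvgP cv := cvg_pseries_bin _ 0 1 _ q1.
exact: (is_cvg_seriesZ (k := (`|M| + 1) / `|K|) cv).
Qed.

(** [pseries_snd_diffs] asks that the series and its first two derived series converge at one point
    beyond |x|; any b between |x| and K serves. *)
Lemma is_derive_pseries (R : realType) (c : R^nat) (K : R) (f : R -> R) x :
  (forall z, `|z| < K -> pseries c z @ \oo --> f z) -> `|x| < K ->
  [/\ cvgn (pseries (pseries_diffs c) x) &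
      is_derive x (1 : R) f (limn (pseries (pseries_diffs c) x))].
Proof.
have mid a : 0 <= a -> a < K -> exists2 b, 0 < b & a < b < K.
  by move=> a0 aK; exists ((a + K) / 2); [lra|apply/andP; split; lra].
move=> cf xK; have cc z : `|z| < K -> cvgn (pseries c z).
  by move=> /cf/cvgP.
(* Stated on the whole open interval, so that it can be applied twice. *)
have dc (d : R^nat) : (forall z, `|z| < K -> cvgn (pseries d z)) ->
    forall z, `|z| < K -> cvgn (pseries (pseries_diffs d) z).
  move=> dK z /(mid _ (normr_ge0 z))[b b0 /andP[zb bK]].
  by apply: (@is_cvg_pseries_diffs _ _ b); [apply: dK|]; rewrite [`|b|]gtr0_norm.
split; first exact: dc.
have [b b0 /andP[xb bK]] := mid _ (normr_ge0 x) xK.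
have bK' : `|b| < K by rewrite gtr0_norm.
apply: (@near_eq_is_derive _ _ _ (fun z => limn (pseries c z))).
  near=> z; apply/cvg_lim => //; apply: cf.
  suff : z \in `]-K, K[ by rewrite in_itv /= -ltr_norml.
  by near: z; apply: near_in_itvoo; rewrite in_itv /= -ltr_norml.
apply: (@pseries_snd_diffs _ _ b).
- exact: cc.
- exact: (dc _ cc).
- exact: (dc _ (dc _ cc)).
- by rewrite [ltRHS]gtr0_norm.
Unshelve. all: by end_near. Qed.

Lemma cvg_pseries_euler (R : realType) (c : R^nat) (f : R -> R) (a K x : R) :
  (forall z, `|z| < K -> pseries c z @ \oo --> f z) -> `|x| < K ->
  pseries (fun n => (n%:R - a) * c n) x @ \oo --> x * f^`()%classic x - a * f x.
Proof.
move=> cf xK; have [cd fd] := is_derive_pseries _ _ _ _ _ cf xK.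
rewrite derive1E derive_val.
have -> : pseries (fun n => (n%:R - a) * c n) x
    = (fun N => x * [series n%:R * c n * x ^+ n.-1]_n N - a * pseries c x N).
  apply/funext => N; rewrite /pseries /series /= !mulr_sumr -sumrB.
  (* At n = 0 the truncated exponent [n.-1] is harmless, as the factor n is 0. *)
  by apply: eq_bigr => -[|n] _ /=; rewrite ?exprS; ring.
apply: cvgB; apply: cvgM; [exact: cvg_cst| |exact: cvg_cst|exact: cf].
exact: pseries_diffs_equiv.
Qed.

(** [c] and [f] vary in the induction: the factor with the largest multiple of [lam] acts first and
    changes both. *)
Lemma cvg_pseries_deuler (R : realType) (lam K : R) p (c : R^nat) (f : R -> R) :
  (forall z, `|z| < K -> pseries c z @ \oo --> f z) ->
  forall z, `|z| < K ->
    pseries (fun n => dfalling lam p n%:R * c n) z @ \oo --> deuler lam p f z.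
Proof.
elim: p c f => [|p IHp] c f cf z zK.
  under eq_fun do rewrite /dfalling big_ord0 mul1r.
  exact: cf.
under eq_fun do rewrite dfallingS -mulrA.
by apply: IHp => // y yK; exact: cvg_pseries_euler yK.
Qed.

(** * Exchange of the series with the finite sum over k *)

Lemma cvg_series_sum (R : realType) n (u : nat -> R^nat) (l : nat -> R) :
  (forall k, series (u k) @ \oo --> l k) ->
  series (fun i => \sum_(k < n) u k i) @ \oo --> \sum_(k < n) l k.
Proof.
move=> ul; have -> : series (fun i => \sum_(k < n) u k i)
    = (fun N => \sum_(k < n) series (u k) N).
  by apply/funext => N; rewrite /series /= exchange_big.
by apply: cvg_big => // ? ?; exact: add_continuous.
Qed.

(** The range of [k] does not depend on [j], which lets the series in [j] pass inside the sum. *)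
Lemma bin_mul_dfalling (R : realType) (lam : R) p r j :
  'C(j + r, j)%:R * dfalling lam p j%:R
    = \sum_(k < size (dfubini lam p))
        'C(k + r, r)%:R * (dfubini lam p)`_k * 'C(j + r, k + r)%:R.
Proof.
rewrite -newton_eval_dfubini newton_eval_wide mulr_sumr -{1}(bin_sub (leq_addr r j)).
rewrite addKn; apply: eq_bigr => k _.
by rewrite mulrCA -natrM mul_binDr natrM; ring.
Qed.

Theorem theorem11 (R : realType) (lam : R) (p r : nat) (hp : (0 < p)%N)
    (x : R) (hx : `|x| < 1) :
  [/\ cvgn (series (fun n : nat =>
        'C(n + r, n)%:R * dfalling lam p n%:R * x ^+ n)),
      deuler lam p (fun y : R => (1 / (1 - y)) ^+ r.+1) x
        = limn (series (fun n : nat =>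
            'C(n + r, n)%:R * dfalling lam p n%:R * x ^+ n))
    & limn (series (fun n : nat =>
        'C(n + r, n)%:R * dfalling lam p n%:R * x ^+ n))
        = (1 / (1 - x)) ^+ r.+1
          * (opD r (dfubini lam p)).[x / (1 - x)]].
Proof.
have cvgL : series (fun n : nat =>
      'C(n + r, n)%:R * dfalling lam p n%:R * x ^+ n) @ \oo
    --> deuler lam p (fun y : R => (1 / (1 - y)) ^+ r.+1) x.
  under eq_fun do rewrite [_ * dfalling _ _ _]mulrC.
  apply: (cvg_pseries_deuler _ _ 1) => // z z1.
  have := cvg_pseries_bin _ 0 r _ z1.
  rewrite expr0 mul1r add0n.
  by under eq_fun do rewrite -bin_sub ?leq_addl // addnK.
have cvgR : series (fun n : nat =>
      'C(n + r, n)%:R * dfalling lam p n%:R * x ^+ n) @ \oo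
    --> (1 / (1 - x)) ^+ r.+1 * (opD r (dfubini lam p)).[x / (1 - x)].
  under eq_fun do rewrite bin_mul_dfalling mulr_suml.
  rewrite horner_opD mulr_sumr.
  pose a k := 'C(k + r, r)%:R * (dfubini lam p)`_k.
  (* The denominators of (x / (1 - x))^k join the outer power, giving the limits in
     [cvg_pseries_bin]. *)
  under [X in nbhs X]eq_bigr => k _.
    have -> : (1 / (1 - x)) ^+ r.+1 * (a k * (x / (1 - x)) ^+ k)
        = a k * (x ^+ k * (1 / (1 - x)) ^+ (k + r).+1).
      by rewrite -addnS exprD !expr_div_n !expr1n; ring.
    over.
  apply: (cvg_series_sum _ _ (fun k n => a k * 'C(n + r, k + r)%:R * x ^+ n)
    (fun k => a k * (x ^+ k * (1 / (1 - x)) ^+ (k + r).+1))) => k.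
  have -> : series (fun n => a k * 'C(n + r, k + r)%:R * x ^+ n)
      = (fun N => a k * pseries (fun n => 'C(n + r, k + r)%:R) x N).
    apply/funext => N; rewrite /pseries /series /= mulr_sumr.
    by apply: eq_bigr => n _; rewrite mulrA.
  by apply: cvgM; [exact: cvg_cst|exact: cvg_pseries_bin].
by split; [exact: cvgP cvgL|apply/esym/cvg_lim|apply/cvg_lim].
Qed.
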